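(* The complex Lie algebra $(\mathfrak{e}_{7,\mathbb{R}})^{\mathbb{C}}$ is isomorphic to the Lie algebra $\mathfrak{sp}(3,\mathbb{H}^{\mathbb{C}})$: $(\mathfrak{e}_{7,\mathbb{R}})^{\mathbb{C}}\cong\mathfrak{sp}(3,\mathbb{H}^{\mathbb{C}})$.
   Context: $\mathbb{H}^{\mathbb{C}}=\mathbb{H}\otimes_{\mathbb{R}}\mathbb{C}$ is the complexified quaternion algebra with quaternionic conjugation extended $\mathbb{C}$-linearly; $\mathfrak{sp}(3,\mathbb{H}^{\mathbb{C}})=\{D\in M(3,\mathbb{H}^{\mathbb{C}})\mid D+D^*=0\}$, where $D^*$ is the transpose of the entrywise quaternionic conjugate, with commutator bracket. Let $(\mathfrak{J}_{\mathbb{R}})^{\mathbb{C}}$ be the space of symmetric $3\times3$ complex matrices with $X\circ Y=\frac12(XY+YX)$, $(X,Y)=\mathrm{tr}(X\circ Y)$, and $X\times Y=\frac12\bigl(2X\circ Y-\mathrm{tr}(X)Y-\mathrm{tr}(Y)X+(\mathrm{tr}(X)\mathrm{tr}(Y)-(X,Y))E\bigr)$. Let $(\mathfrak{e}_{6,\mathbb{R}})^{\mathbb{C}}=\{\phi\in\mathrm{Hom}_{\mathbb{C}}((\mathfrak{J}_{\mathbb{R}})^{\mathbb{C}})\mid(\phi X,X\times X)=0\ \forall X\}$; ${}^t\phi$ is the transpose with respect to $(X,Y)$. Let $(\mathfrak{P}_{\mathbb{R}})^{\mathbb{C}}=(\mathfrak{J}_{\mathbb{R}})^{\mathbb{C}}\oplus(\mathfrak{J}_{\mathbb{R}})^{\mathbb{C}}\oplus\mathbb{C}\oplus\mathbb{C}$.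 For $\phi\in(\mathfrak{e}_{6,\mathbb{R}})^{\mathbb{C}}$, $A,B\in(\mathfrak{J}_{\mathbb{R}})^{\mathbb{C}}$, $\nu\in\mathbb{C}$, define the endomorphism $\Phi(\phi,A,B,\nu)(X,Y,\xi,\eta)=(\phi X-\frac13\nu X+2B\times Y+\eta A,\ 2A\times X-{}^t\phi Y+\frac13\nu Y+\xi B,\ (A,Y)+\nu\xi,\ (B,X)-\nu\eta)$. Then $(\mathfrak{e}_{7,\mathbb{R}})^{\mathbb{C}}=\{\Phi(\phi,A,B,\nu)\mid\phi\in(\mathfrak{e}_{6,\mathbb{R}})^{\mathbb{C}},\ A,B\in(\mathfrak{J}_{\mathbb{R}})^{\mathbb{C}},\ \nu\in\mathbb{C}\}$, with commutator bracket in $\mathrm{Hom}_{\mathbb{C}}((\mathfrak{P}_{\mathbb{R}})^{\mathbb{C}})$ ($\mathrm{Hom}_{\mathbb{C}}(V)$ denotes $\mathbb{C}$-linear endomorphisms of $V$). *)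

(* Defs.v *)
From HB Require Import structures.
From mathcomp Require Import all_boot all_order all_algebra.
From mathcomp Require Import ring.

Set Implicit Arguments.
Unset Strict Implicit.
Unset Printing Implicit Defensive.

Import GRing.Theory Num.Theory.
Local Open Scope ring_scope.

HB.mixin Record isLieAlgebra (K : pzRingType) L of GRing.Lmodule K L := {
  lie : L -> L -> L;
  lie_linearl : forall z, linear (lie^~ z);
  lie_linearr : forall z, linear (lie z);
  lie_alt : forall x, lie x x = 0;
  lie_jacobi : forall x y z,
    lie x (lie y z) + lie y (lie z x) + lie z (lie x y) = 0
}.

#[short(type="lieAlgType")]
HB.structure Definition LieAlgebra (K : pzRingType) :=
  { L of GRing.Lmodule K L & isLieAlgebra K L }.

Definition lie_subalgebra (K : pzRingType) (L : lieAlgType K) (S : L -> Prop) :=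
  [/\ S 0,
      forall (a : K) x y, S x -> S y -> S (a *: x + y)
    & forall x y, S x -> S y -> S (lie x y)].

(* [S] and [T] are Lie subalgebras, isomorphic as Lie algebras; only the
   restriction of [f] to [S] matters. *)
Definition lie_isomorphic (K : pzRingType) (L M : lieAlgType K)
    (S : L -> Prop) (T : M -> Prop) :=
  [/\ lie_subalgebra S, lie_subalgebra T
    & exists f : L -> M,
      [/\ forall x, S x -> T (f x),
          forall (a : K) x y, S x -> S y -> f (a *: x + y) = a *: f x + f y,
          forall x y, S x -> S y -> f (lie x y) = lie (f x) (f y),
          forall x y, S x -> S y -> f x = f y -> x = y
        & forall z, T z -> exists2 x, S x & f x = z]].

(* The Jacobi identity of a commutator; [xyz] stands for a product x * y * z,
   and similarly for the other variables. *)
Fact commutator_jacobi (V : zmodType) (xyz yzx zxy xzy zyx yxz : V) :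
  (xyz - xzy - (yzx - zyx)) + (yzx - yxz - (zxy - xzy))
    + (zxy - zyx - (xyz - yxz)) = 0.
Proof.
rewrite !opprB !addrA [LHS](ACl (1*12*3*10*5*4*7*2*9*8*11*6))%AC /=.
by rewrite !(subrr, add0r).
Qed.

Section EndLie.
Variables (K : comNzRingType) (V : vectType K).
Implicit Types f g h : 'End(V).

Definition end_lie f g : 'End(V) := (f \o g)%VF - (g \o f)%VF.

Fact end_lie_linearl h : linear (end_lie^~ h).
Proof.
move=> a f g; rewrite /end_lie comp_lfunDl comp_lfunDr -comp_lfunZl -comp_lfunZr.
by rewrite scalerBr opprD !addrA [LHS](ACl (1*3*2*4))%AC.
Qed.

Fact end_lie_linearr h : linear (end_lie h).
Proof.
move=> a f g; rewrite /end_lie comp_lfunDl comp_lfunDr -comp_lfunZl -comp_lfunZr.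
by rewrite scalerBr opprD !addrA [LHS](ACl (1*3*2*4))%AC.
Qed.

Fact end_lie_alt f : end_lie f f = 0.
Proof. exact: subrr. Qed.

Fact end_lie_jacobi f g h :
  end_lie f (end_lie g h) + end_lie g (end_lie h f) + end_lie h (end_lie f g)
    = 0.
Proof.
rewrite /end_lie !(comp_lfunDl, comp_lfunDr, comp_lfunNl, comp_lfunNr).
rewrite !comp_lfunA; exact: commutator_jacobi.
Qed.

HB.instance Definition _ := isLieAlgebra.Build K 'End(V)
  end_lie_linearl end_lie_linearr end_lie_alt end_lie_jacobi.

End EndLie.

(* Hamilton quaternions a + b i + c j + d k over a commutative ring [K].  As
   the real quaternions have basis 1, i, j, k over R, their complexification
   is [quat K] for K the complex numbers, with [qconj] (linear over K) as the
   extended conjugation. *)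
Record quat (K : Type) := Quat { q1 : K; qi : K; qj : K; qk : K }.

Definition quat_prod K (p : quat K) := (q1 p, qi p, qj p, qk p).
Definition prod_quat K (t : K * K * K * K) :=
  let: (a, b, c, d) := t in Quat a b c d.
Fact quat_prodK K : cancel (@quat_prod K) (@prod_quat K).
Proof. by case. Qed.

HB.instance Definition _ (K : eqType) :=
  Equality.copy (quat K) (can_type (@quat_prodK K)).
HB.instance Definition _ (K : choiceType) :=
  Choice.copy (quat K) (can_type (@quat_prodK K)).

Section Quaternions.
Variable K : comNzRingType.
Implicit Types p q r : quat K.

Definition addq p q :=
  Quat (q1 p + q1 q) (qi p + qi q) (qj p + qj q) (qk p + qk q).
Definition oppq p := Quat (- q1 p) (- qi p) (- qj p) (- qk p).
Definition zeroq : quat K := Quat 0 0 0 0.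

Fact addqA : associative addq.
Proof. by move=> p q r; congr Quat; exact: addrA. Qed.
Fact addqC : commutative addq.
Proof. by move=> p q; congr Quat; exact: addrC. Qed.
Fact add0q : left_id zeroq addq.
Proof. by case=> *; congr Quat; exact: add0r. Qed.
Fact addNq : left_inverse zeroq oppq addq.
Proof. by case=> *; congr Quat; exact: addNr. Qed.

HB.instance Definition _ :=
  GRing.isZmodule.Build (quat K) addqA addqC add0q addNq.

Definition oneq : quat K := Quat 1 0 0 0.
Definition mulq p q := Quat
  (q1 p * q1 q - qi p * qi q - qj p * qj q - qk p * qk q)
  (q1 p * qi q + qi p * q1 q + qj p * qk q - qk p * qj q)
  (q1 p * qj q - qi p * qk q + qj p * q1 q + qk p * qi q)
  (q1 p * qk q + qi p * qj q - qj p * qi q + qk p * q1 q).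

Fact mulqA : associative mulq.
Proof. by move=> p q r; congr Quat => /=; ring. Qed.
Fact mul1q : left_id oneq mulq.
Proof. by case=> *; congr Quat => /=; ring. Qed.
Fact mulq1 : right_id oneq mulq.
Proof. by case=> *; congr Quat => /=; ring. Qed.
Fact mulqDl : left_distributive mulq addq.
Proof. by move=> p q r; congr Quat => /=; ring. Qed.
Fact mulqDr : right_distributive mulq addq.
Proof. by move=> p q r; congr Quat => /=; ring. Qed.
Fact oneq_neq0 : oneq != zeroq.
Proof. by apply/eqP => -[] /eqP; rewrite oner_eq0. Qed.

HB.instance Definition _ := GRing.Zmodule_isNzRing.Build (quat K)
  mulqA mul1q mulq1 mulqDl mulqDr oneq_neq0.

Definition scaleq (a : K) p := Quat (a * q1 p) (a * qi p) (a * qj p) (a * qk p).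

Fact scaleqA a b p : scaleq a (scaleq b p) = scaleq (a * b) p.
Proof. by congr Quat; exact: mulrA. Qed.
Fact scale1q : left_id 1 scaleq.
Proof. by case=> *; congr Quat; exact: mul1r. Qed.
Fact scaleqDr : right_distributive scaleq +%R.
Proof. by move=> a p q; congr Quat; exact: mulrDr. Qed.
Fact scaleqDl p : {morph scaleq^~ p : a b / a + b}.
Proof. by move=> a b; congr Quat; exact: mulrDl. Qed.

HB.instance Definition _ := GRing.Zmodule_isLmodule.Build K (quat K)
  scaleqA scale1q scaleqDr scaleqDl.

Fact scaleqAl (a : K) p q : a *: (p * q) = (a *: p) * q.
Proof. by congr Quat => /=; ring. Qed.
HB.instance Definition _ := GRing.Lmodule_isLalgebra.Build K (quat K) scaleqAl.

Fact scaleqAr (a : K) p q : a *: (p * q) = p * (a *: q).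
Proof. by congr Quat => /=; ring. Qed.
HB.instance Definition _ := GRing.Lalgebra_isAlgebra.Build K (quat K) scaleqAr.

Definition qconj p := Quat (q1 p) (- qi p) (- qj p) (- qk p).

End Quaternions.

(* An alias, so that quaternionic matrices carry their structure of a module
   over [K] and not over the quaternions. *)
Definition quat_mx (K : comNzRingType) : Type := 'M[quat K]_3.

Section QuaternionMatrices.
Variable K : comNzRingType.
Implicit Types D : quat_mx K.

HB.instance Definition _ := GRing.Zmodule.copy (quat_mx K) 'M[quat K]_3.

Definition scale_qmx (a : K) D : quat_mx K := map_mx (fun q => a *: q) D.

Fact scale_qmxA a b D : scale_qmx a (scale_qmx b D) = scale_qmx (a * b) D.
Proof. by apply/matrixP => i j; rewrite !mxE scalerA. Qed.
Fact scale_qmx1 : left_id 1 scale_qmx.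
Proof. by move=> D; apply/matrixP => i j; rewrite !mxE scale1r. Qed.
Fact scale_qmxDr : right_distributive scale_qmx +%R.
Proof. by move=> a D D'; apply/matrixP => i j; rewrite !mxE scalerDr. Qed.
Fact scale_qmxDl D : {morph scale_qmx^~ D : a b / a + b}.
Proof. by move=> a b; apply/matrixP => i j; rewrite !mxE scalerDl. Qed.

HB.instance Definition _ := GRing.Zmodule_isLmodule.Build K (quat_mx K)
  scale_qmxA scale_qmx1 scale_qmxDr scale_qmxDl.

Definition qmx_lie D D' : quat_mx K := D *m D' - D' *m D.

Fact scale_qmxAl (a : K) D D' : a *: (D *m D' : quat_mx K) = (a *: D) *m D'.
Proof.
apply/matrixP => i j; rewrite !mxE scaler_sumr; apply: eq_bigr => k _.
by rewrite mxE scalerAl.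
Qed.
Fact scale_qmxAr (a : K) D D' : a *: (D *m D' : quat_mx K) = D *m (a *: D').
Proof.
apply/matrixP => i j; rewrite !mxE scaler_sumr; apply: eq_bigr => k _.
by rewrite mxE scalerAr.
Qed.

Fact qmx_lie_linearl D : linear (qmx_lie^~ D).
Proof.
move=> a D1 D2; rewrite /qmx_lie mulmxDl mulmxDr -scale_qmxAl -scale_qmxAr.
by rewrite scalerBr opprD !addrA [LHS](ACl (1*3*2*4))%AC.
Qed.

Fact qmx_lie_linearr D : linear (qmx_lie D).
Proof.
move=> a D1 D2; rewrite /qmx_lie mulmxDl mulmxDr -scale_qmxAl -scale_qmxAr.
by rewrite scalerBr opprD !addrA [LHS](ACl (1*3*2*4))%AC.
Qed.

Fact qmx_lie_alt D : qmx_lie D D = 0.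
Proof. exact: subrr. Qed.

Fact qmx_lie_jacobi D1 D2 D3 :
  qmx_lie D1 (qmx_lie D2 D3) + qmx_lie D2 (qmx_lie D3 D1)
    + qmx_lie D3 (qmx_lie D1 D2) = 0.
Proof.
rewrite /qmx_lie !(mulmxBl, mulmxBr) !mulmxA; exact: commutator_jacobi.
Qed.

HB.instance Definition _ := isLieAlgebra.Build K (quat_mx K)
  qmx_lie_linearl qmx_lie_linearr qmx_lie_alt qmx_lie_jacobi.

Definition qadj D : quat_mx K := map_mx (@qconj K) D^T.

Definition sp3 D : Prop := D + qadj D = 0.

End QuaternionMatrices.

Section SymmetricMatrices.
Variable K : numFieldType.

Definition sym_pred : {pred 'M[K]_3} := fun X => X^T == X.

Fact sym_predP X : reflect (X^T = X) (X \in sym_pred).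
Proof. exact: eqP. Qed.

Record symmx := SymMx { symval :> 'M[K]_3; _ : symval \in sym_pred }.

HB.instance Definition _ := [isSub for symval].
HB.instance Definition _ := [Choice of symmx by <:].

Fact sym_submod : submod_closed sym_pred.
Proof.
split=> [|a X Y /sym_predP sX /sym_predP sY]; apply/sym_predP; first exact: trmx0.
by rewrite linearP /= sX sY.
Qed.
HB.instance Definition _ :=
  GRing.isSubmodClosed.Build K 'M[K]_3 sym_pred sym_submod.
HB.instance Definition _ := [SubChoice_isSubLmodule of symmx by <:].

Lemma symmxE (X : symmx) i j : X i j = X j i.
Proof. by case: X => X sX /=; rewrite -[in LHS](sym_predP _ sX) mxE. Qed.

(* Coordinates of a symmetric matrix: the diagonal, then (0,1), (0,2), (1,2). *)
Definition sym_coord (X : symmx) : 'rV[K]_6 :=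
  \row_(k < 6) nth 0 [:: X 0 0; X 1 1; X 2%:R 2%:R; X 0 1; X 0 2%:R; X 1 2%:R] k.

Definition coord_symmx (v : 'rV[K]_6) : 'M[K]_3 :=
  \matrix_(i, j) v 0 (if i == j then inord i else inord (i + j + 2)).

Fact coord_symmx_sym v : coord_symmx v \in sym_pred.
Proof.
apply/sym_predP/matrixP => i j; rewrite !mxE [j == i]eq_sym [(j + i)%N]addnC.
by case: (i =P j) => // ->.
Qed.

Fact symmx_vect_axiom : Vector.axiom 6 symmx.
Proof.
exists sym_coord.
  by move=> a X Y; apply/rowP => -[[|[|[|[|[|[|k]]]]]] kP]; rewrite !mxE //= !mxE.
exists (fun v => SymMx (coord_symmx_sym v)) => [X | v].
  apply/val_inj/matrixP => i j; rewrite !mxE /=.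
  case: i j => [[|[|[|i]]] iP] [[|[|[|j]]] jP] //=; rewrite inordK //=;
    first [ by congr (symval X _ _); exact: val_inj
          | by rewrite symmxE; congr (symval X _ _); exact: val_inj ].
by apply/rowP => -[[|[|[|[|[|[|k]]]]]] kP]; rewrite !mxE //=;
  congr (v _ _); apply: val_inj; rewrite /= ?inordK.
Qed.

HB.instance Definition _ := Lmodule_hasFinDim.Build K symmx symmx_vect_axiom.

End SymmetricMatrices.

Section Jordan.
Variable K : numFieldType.
Local Notation J := (symmx K).
Implicit Types (X Y Z A B : J) (phi : 'End(J)).

Fact half_double (a : K) : 2%:R^-1 * (a + a) = a.
Proof. by field. Qed.

Fact jordan_sym X Y : 2%:R^-1 *: (X *m Y + Y *m X) \in @sym_pred K.
Proof.
case: X Y => [X /= /sym_predP sX] [Y /= /sym_predP sY].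
by apply/sym_predP; rewrite linearZ linearD /= !trmx_mul sX sY addrC.
Qed.
Definition jordan X Y : J := SymMx (jordan_sym X Y).

Fact sym_one : 1%:M \in @sym_pred K.
Proof. by apply/sym_predP; exact: trmx1. Qed.
Definition jone : J := SymMx sym_one.

Definition jform X Y : K := \tr (jordan X Y).

Definition cross X Y : J :=
  2%:R^-1 *: (2%:R *: jordan X Y - \tr X *: Y - \tr Y *: X
              + (\tr X * \tr Y - jform X Y) *: jone).

Definition e6 phi : Prop := forall X, jform (phi X) (cross X X) = 0.

(* The transpose of [phi] is given by an explicit formula: as
   (1/2 (E_ij + E_ji), Z) = Z_ij for symmetric Z, the (i, j) entry of the
   transpose at Y is (phi (1/2 (E_ij + E_ji)), Y).  See [jform_adj]. *)
Fact sym_unit_sym i j :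
  2%:R^-1 *: (delta_mx i j + delta_mx j i) \in @sym_pred K.
Proof.
by apply/sym_predP; rewrite linearZ linearD /= !trmx_delta addrC.
Qed.
Definition sym_unit i j : J := SymMx (sym_unit_sym i j).

Fact adj_sym phi Y :
  \matrix_(i, j) jform (phi (sym_unit i j)) Y \in @sym_pred K.
Proof.
apply/sym_predP/matrixP => i j; rewrite !mxE; congr (jform (phi _) _).
by apply/val_inj; rewrite /= addrC.
Qed.
Definition adj_fun phi Y : J := SymMx (adj_sym phi Y).

Lemma jformE X Y : jform X Y = \sum_i \sum_j X i j * Y i j.
Proof.
rewrite /jform /jordan /= mxtraceZ mxtraceD [\tr (Y *m X)]mxtrace_mulC.
rewrite half_double.
apply: eq_bigr => i _; rewrite mxE; apply: eq_bigr => j _.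
by rewrite [Y j i]symmxE.
Qed.

Lemma jformC X Y : jform X Y = jform Y X.
Proof.
rewrite !jformE; apply: eq_bigr => i _; apply: eq_bigr => j _; exact: mulrC.
Qed.

Fact jform_linearr X : linear_for *%R (jform X).
Proof.
move=> a Y Z; rewrite !jformE mulr_sumr -big_split; apply: eq_bigr => i _ /=.
rewrite mulr_sumr -big_split; apply: eq_bigr => j _ /=.
by rewrite !mxE mulrDr mulrCA.
Qed.
HB.instance Definition _ X :=
  GRing.isLinear.Build K J K *%R (jform X) (jform_linearr X).

Fact adj_linear phi : linear (adj_fun phi).
Proof.
by move=> a X Y; apply/val_inj/matrixP => i j; rewrite !mxE linearP.
Qed.
HB.instance Definition _ phi :=
  GRing.isLinear.Build K J J *:%R (adj_fun phi) (adj_linear phi).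

Definition adj phi : 'End(J) := linfun (adj_fun phi).

Fact mxtrace_delta_mul i j (Z : 'M[K]_3) : \tr (delta_mx i j *m Z) = Z j i.
Proof.
rewrite /mxtrace (bigD1 i) //= big1 ?addr0 => [|k ki]; rewrite mxE.
  rewrite (bigD1 j) //= big1 ?addr0 => [|l lj]; rewrite mxE ?eqxx ?mul1r //.
  by rewrite (negPf lj) andbF mul0r.
by apply: big1 => l _; rewrite mxE (negPf ki) mul0r.
Qed.

Lemma jform_unit i j Z : jform (sym_unit i j) Z = Z i j.
Proof.
rewrite /jform /= mxtraceZ mxtraceD [\tr (Z *m _)]mxtrace_mulC.
rewrite half_double -scalemxAl mxtraceZ mulmxDl mxtraceD.
rewrite !mxtrace_delta_mul [Z j i]symmxE.
by rewrite half_double.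
Qed.

Lemma sym_unit_sum X : X = \sum_i \sum_j X i j *: sym_unit i j.
Proof.
apply: val_inj; rewrite raddf_sum.
under eq_bigr do rewrite raddf_sum; rewrite /=.
pose S (Z : 'M[K]_3) := \sum_i \sum_j Z i j *: delta_mx i j.
transitivity (2%:R^-1 *: (S X + S X^T)).
  by rewrite /S -!matrix_sum_delta (sym_predP _ (valP X)) -mulr2n -scaler_nat
             scalerA mulVf ?pnatr_eq0 ?scale1r.
rewrite /S [X in _ + X]exchange_big -big_split scaler_sumr.
apply: eq_bigr => i _; rewrite -big_split scaler_sumr.
apply: eq_bigr => j _ /=; rewrite mxE -scalerDr !scalerA; congr (_ *: _).
exact: mulrC.
Qed.

Lemma jform_adj phi X Y : jform (phi X) Y = jform X (adj phi Y).
Proof.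
rewrite {1}[X]sym_unit_sum linear_sum jformC linear_sum jformE /=.
apply: eq_bigr => i _; rewrite !linear_sum; apply: eq_bigr => j _.
by rewrite !linearZ /= jformC lfunE mxE.
Qed.

Fact cross_linearr X : linear (cross X).
Proof.
move=> a Y Z; apply/val_inj/matrixP => i j.
rewrite /cross (linearP (jform X)) /= !mulmxDl !mulmxDr -!scalemxAl -!scalemxAr.
rewrite mxtraceD mxtraceZ !mxE /=; ring.
Qed.
HB.instance Definition _ X :=
  GRing.isLinear.Build K J J *:%R (cross X) (cross_linearr X).

End Jordan.

Section E7.
Variable K : numFieldType.
Local Notation J := (symmx K).

Definition freudenthal : Type := (J * J * K^o * K^o)%type.
HB.instance Definition _ := Vector.copy freudenthal (J * J * K^o * K^o)%type.

Definition Phi_fun (phi : 'End(J)) (A B : J) (nu : K) (P : freudenthal) : freudenthal :=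
  let: (X, Y, xi, eta) := P in
  (phi X - (3%:R^-1 * nu) *: X + 2%:R *: cross B Y + eta *: A,
   2%:R *: cross A X - adj phi Y + (3%:R^-1 * nu) *: Y + xi *: B,
   jform A Y + nu * xi,
   jform B X - nu * eta).

Fact lin_comb4 (V : lmodType K) (a e e' : K) (p n c v p' n' c' : V) :
  a *: p + p' + (a *: n + n') + (a *: c + c') + (a * e + e') *: v =
    a *: (p + n + c + e *: v) + (p' + n' + c' + e' *: v).
Proof.
rewrite scalerDl -scalerA !scalerDr !addrA.
by rewrite [LHS](ACl (1*3*5*7*2*4*6*8))%AC.
Qed.

Fact Phi_linear phi A B nu : linear (Phi_fun phi A B nu).
Proof.
move=> a [[[X Y] xi] eta] [[[X' Y'] xi'] eta'] /=.
congr (_, _, _, _); rewrite !linearP /=.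
- exact: lin_comb4.
- exact: lin_comb4.
- by rewrite -[a *: xi]/(a * xi) -[a *: (_ + _)]/(a * _); ring.
- by rewrite -[a *: eta]/(a * eta) -[a *: (_ - _)]/(a * _); ring.
Qed.
HB.instance Definition _ phi A B nu :=
  GRing.isLinear.Build K freudenthal freudenthal *:%R (Phi_fun phi A B nu)
    (Phi_linear phi A B nu).

Definition Phi phi A B nu : 'End(freudenthal) := linfun (Phi_fun phi A B nu).

Lemma PhiE phi A B nu X Y (xi eta : K) :
  Phi phi A B nu (X, Y, xi, eta) =
    (phi X - (3%:R^-1 * nu) *: X + 2%:R *: cross B Y + eta *: A,
     2%:R *: cross A X - adj phi Y + (3%:R^-1 * nu) *: Y + xi *: B,
     jform A Y + nu * xi,
     jform B X - nu * eta) :> freudenthal.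
Proof. by rewrite lfunE. Qed.

Definition e7 (f : 'End(freudenthal)) : Prop :=
  exists (phi : 'End(J)) (A B : J) (nu : K), e6 phi /\ f = Phi phi A B nu.

End E7.

(* Main.v *)
(* Both algebras are isomorphic to sp(6, C), seen as the triples (N, A, B) of a
   3 x 3 matrix and two symmetric matrices standing for [[N, A], [B, - N^T]].
   - The elements of e6 are the maps X |-> M X + X M^T with tr M = 0: polarizing
     the defining cubic identity and evaluating it on a basis of the symmetric
     matrices determines all the coordinates of phi.  Then
     N = M + (nu / 3) 1 turns Phi(phi, A, B, nu) into (N, A, B), and the choice
     nu = tr N makes the bracket that of sp(6).
   - The isomorphism of the complexified quaternions with M(2, C) turns
     quaternionic conjugation into the adjugate, hence sp(3, H^C) into sp(6, C). *)
From HB Require Import structures.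
Require Import Defs.
From mathcomp Require Import all_boot all_order all_algebra ring.
From mathcomp Require Import reals complex.

Set Implicit Arguments.
Unset Strict Implicit.
Unset Printing Implicit Defensive.

Import GRing.Theory Num.Theory.
Local Open Scope ring_scope.

(** * Explicit coordinates for 3 x 3 matrices *)

Lemma ord3_ind (P : 'I_3 -> Prop) :
  P 0 -> P 1 -> P 2 -> forall i, P i.
Proof.
by move=> P0 P1 P2 [[|[|[|i]]] iP] //;
  [move: P0|move: P1|move: P2]; congr (P _); apply: val_inj.
Qed.

Lemma sum3E (V : nmodType) (F : 'I_3 -> V) :
  \sum_(k < 3) F k = F 0 + F 1 + F 2.
Proof.
rewrite !big_ord_recl big_ord0 addr0 addrA.
by congr (_ + F _ + F _); apply: val_inj.
Qed.

(** Matrices are put in this form by [mx3_eta], so that matrix identities reduce to scalar ones for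
    [ring] and [field]. *)
Definition mx3 (T : nzRingType) (a b c d e f g h k : T) : 'M[T]_3 :=
  \matrix_(i, j) nth 0 (nth [::] [:: [:: a; b; c]; [:: d; e; f]; [:: g; h; k]] i) j.

Lemma mx3_eta (T : nzRingType) (M : 'M[T]_3) :
  M = mx3 (M 0 0) (M 0 1) (M 0 2) (M 1 0) (M 1 1) (M 1 2) (M 2 0) (M 2 1) (M 2 2).
Proof.
by apply/matrixP => i j; elim/ord3_ind: i; elim/ord3_ind: j; rewrite mxE.
Qed.

Section Mx3.
Variable T : comNzRingType.
Variables a b c d e f g h k a' b' c' d' e' f' g' h' k' x : T.
Local Notation M := (mx3 a b c d e f g h k).
Local Notation M' := (mx3 a' b' c' d' e' f' g' h' k').

Lemma mx3D : M + M' =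
  mx3 (a + a') (b + b') (c + c') (d + d') (e + e') (f + f') (g + g') (h + h') (k + k').
Proof.
by apply/matrixP => i j; elim/ord3_ind: i; elim/ord3_ind: j; rewrite !mxE.
Qed.

Lemma mx3N : - M = mx3 (- a) (- b) (- c) (- d) (- e) (- f) (- g) (- h) (- k).
Proof.
by apply/matrixP => i j; elim/ord3_ind: i; elim/ord3_ind: j; rewrite !mxE.
Qed.

Lemma mx3_tr : M^T = mx3 a d g b e h c f k.
Proof.
by apply/matrixP => i j; elim/ord3_ind: i; elim/ord3_ind: j; rewrite !mxE.
Qed.

Lemma mx3_trace : \tr M = a + e + k.
Proof. by rewrite /mxtrace sum3E !mxE. Qed.

Lemma mx3_scalar : x%:M = mx3 x 0 0 0 x 0 0 0 x.
Proof.
by apply/matrixP => i j; elim/ord3_ind: i; elim/ord3_ind: j; rewrite !mxE.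
Qed.

Lemma mx3M : M *m M' =
  mx3 (a * a' + b * d' + c * g') (a * b' + b * e' + c * h') (a * c' + b * f' + c * k')
      (d * a' + e * d' + f * g') (d * b' + e * e' + f * h') (d * c' + e * f' + f * k')
      (g * a' + h * d' + k * g') (g * b' + h * e' + k * h') (g * c' + h * f' + k * k').
Proof.
by apply/matrixP => i j; elim/ord3_ind: i; elim/ord3_ind: j; rewrite !mxE sum3E !mxE.
Qed.

Lemma mx3Z : x *: M =
  mx3 (x * a) (x * b) (x * c) (x * d) (x * e) (x * f) (x * g) (x * h) (x * k).
Proof.
by apply/matrixP => i j; elim/ord3_ind: i; elim/ord3_ind: j; rewrite !mxE.
Qed.

End Mx3.

Definition mx3E := (mx3D, mx3N, mx3Z, mx3M, mx3_tr, mx3_trace, mx3_scalar).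

(** * Symmetric matrices in coordinates and the action of 3 x 3 matrices on them *)

Section Symmetric.
Variable K : numFieldType.
Local Notation J := (symmx K).
Implicit Types (X Y Z A B : J) (M N : 'M[K]_3).

Fact sym3_sym (a b c d e f : K) : mx3 a d e d b f e f c \in @sym_pred K.
Proof. by apply/sym_predP; rewrite mx3_tr. Qed.

(* In the order of [sym_coord]: the diagonal first. *)
Definition sym3 (a b c d e f : K) : J := SymMx (sym3_sym a b c d e f).

Lemma sym3_val a b c d e f : symval (sym3 a b c d e f) = mx3 a d e d b f e f c.
Proof. by []. Qed.

Lemma sym3_eta X :
  X = sym3 (X 0 0) (X 1 1) (X 2 2) (X 0 1) (X 0 2) (X 1 2).
Proof.
apply: val_inj; rewrite /= [LHS]mx3_eta.
by rewrite [X 1 0]symmxE [X 2 0]symmxE [X 2 1]symmxE.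
Qed.

Fact sym_action_sym N X : N *m X + X *m N^T \in @sym_pred K.
Proof.
apply/sym_predP; rewrite linearD /= !trmx_mul trmxK.
by rewrite (sym_predP _ (valP X)) addrC.
Qed.
(** Infinitesimal form of the action X |-> g X g^T of GL(3). *)
Definition sym_action N X : J := SymMx (sym_action_sym N X).

Fact sym_action_linear N : linear (sym_action N).
Proof.
move=> a X Y; apply: val_inj => /=.
by rewrite mulmxDl mulmxDr -scalemxAl -scalemxAr scalerDr addrACA.
Qed.
HB.instance Definition _ N :=
  GRing.isLinear.Build K J J *:%R (sym_action N) (sym_action_linear N).

Section Coordinates.
Variables a b c d e f a' b' c' d' e' f' x : K.
Local Notation X := (sym3 a b c d e f).
Local Notation X' := (sym3 a' b' c' d' e' f').

Lemma sym3D : X + X' = sym3 (a + a') (b + b') (c + c') (d + d') (e + e') (f + f').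
Proof. by apply: val_inj; rewrite /= mx3D. Qed.

Lemma sym3N : - X = sym3 (- a) (- b) (- c) (- d) (- e) (- f).
Proof. by apply: val_inj; rewrite /= mx3N. Qed.

Lemma sym3Z : x *: X = sym3 (x * a) (x * b) (x * c) (x * d) (x * e) (x * f).
Proof. by apply: val_inj; rewrite /= mx3Z. Qed.

Lemma sym3_form : jform X X' =
  a * a' + b * b' + c * c' + 2 * (d * d' + e * e' + f * f').
Proof. by rewrite jformE !sum3E /= !mxE /=; ring. Qed.

(** This is the polarized adjugate: for X = X' the entries are the cofactors of X. *)
Lemma sym3_cross : cross X X' =
  sym3 (2^-1 * (b * c' + c * b') - f * f')
       (2^-1 * (a * c' + c * a') - e * e')
       (2^-1 * (a * b' + b * a') - d * d')
       (2^-1 * (e * f' + f * e' - c * d' - d * c'))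
       (2^-1 * (d * f' + f * d' - b * e' - e * b'))
       (2^-1 * (d * e' + e * d' - a * f' - f * a')).
Proof.
apply: val_inj; rewrite /cross sym3_form /= !mx3E.
by congr mx3; field.
Qed.

Lemma sym3_action p q r s t u v w y :
  sym_action (mx3 p q r s t u v w y) X =
  sym3 (2 * (p * a + q * d + r * e)) (2 * (s * d + t * b + u * f))
       (2 * (v * e + w * f + y * c))
       (p * d + q * b + r * f + (s * a + t * d + u * e))
       (p * e + q * f + r * c + (v * a + w * d + y * e))
       (s * e + t * f + u * c + (v * d + w * b + y * f)).
Proof.
apply: val_inj; rewrite /= !mx3E.
by congr mx3; ring.
Qed.

End Coordinates.

Definition sym3E :=
  (sym3D, sym3N, sym3Z, sym3_form, sym3_cross, sym3_action, sym3_val).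

Definition coordE := (sym3E, mx3E).

Lemma crossC X Y : cross X Y = cross Y X.
Proof.
rewrite [X]sym3_eta [Y]sym3_eta !sym3_cross; congr sym3; ring.
Qed.

Lemma jform_sym_action N X Y :
  jform (sym_action N X) Y = jform X (sym_action N^T Y).
Proof.
rewrite [N]mx3_eta [X]sym3_eta [Y]sym3_eta ?coordE; ring.
Qed.

(** Entries are pairings with [sym_unit i j], so the adjunction [jform_sym_action] determines the
    transpose. *)
Lemma adj_sym_action N : adj (linfun (sym_action N)) = linfun (sym_action N^T).
Proof.
apply/lfunP => Y; apply/val_inj/matrixP => i j.
by rewrite -!jform_unit -jform_adj !lfunE jform_sym_action.
Qed.

(** Since [cross X X] is the adjugate of X, [jform X (cross X X)] is 3 det X, and pairing with the
    adjugate differentiates det; the derivative of det along N X + X N^T is 2 tr N det X. *)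
Lemma jform_sym_action_cross N X :
  3 * jform (sym_action N X) (cross X X) = 2 * \tr N * jform X (cross X X).
Proof.
by rewrite [N]mx3_eta [X]sym3_eta ?coordE; field.
Qed.

Lemma e6_sym_action N : \tr N = 0 -> e6 (linfun (sym_action N)).
Proof.
move=> N0 X; rewrite lfunE /=; apply/eqP.
rewrite -(mulrI_eq0 _ (mulfI (_ : 3 != 0 :> K))) ?pnatr_eq0 //.
by rewrite jform_sym_action_cross N0 mulr0 mul0r.
Qed.

Lemma sym3_ex X : exists a b c d e f, X = sym3 a b c d e f.
Proof. by do 6!eexists; exact: sym3_eta. Qed.

(** Inclusion-exclusion on the cubic form U |-> T U U U gives the sum of [T] over the six orders of
    X, Y, Z. Symmetry in the last two arguments pairs these terms, hence the factor 2 to cancel. *)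
Lemma polarization (V : zmodType) (T : V -> V -> V -> K) :
  (forall U U' V W, T (U + U') V W = T U V W + T U' V W) ->
  (forall U V V' W, T U (V + V') W = T U V W + T U V' W) ->
  (forall U V W, T U V W = T U W V) ->
  (forall U, T U U U = 0) ->
  forall (X Y Z : V), T X Y Z + T Y Z X + T Z X Y = 0.
Proof.
move=> TDl TDm TC T0 X Y Z.
have TDr U U' W W' : T U U' (W + W') = T U U' W + T U U' W'.
  by rewrite TC TDm !(TC U U').
apply: (mulfI (_ : 2 != 0 :> K)); first by rewrite pnatr_eq0.
pose f U := T U U U.
transitivity (f (X + Y + Z) - f (X + Y) - f (Y + Z) - f (X + Z)
              + f X + f Y + f Z).
  rewrite /f !(TDl, TDm, TDr) !(TC _ Z X) !(TC _ Y X) !(TC _ Z Y); ring.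
by rewrite /f !T0 !(subr0, addr0) mulr0.
Qed.

(** * Determination of e6 from the polarized cubic identity *)

Section E6.
Variable phi : 'End(J).
Hypothesis phiP : e6 phi.

Lemma e6_polarized X Y Z : jform (phi X) (cross Y Z)
  + jform (phi Y) (cross Z X) + jform (phi Z) (cross X Y) = 0.
Proof.
pose T (U V W : J) := jform (phi U) (cross V W).
have TDl U U' V W : T (U + U') V W = T U V W + T U' V W.
  by rewrite /T linearD /= !(jformC _ (cross _ _)) linearD.
have TDm U V V' W : T U (V + V') W = T U V W + T U V' W.
  by rewrite /T !(crossC _ W) !linearD.
have TC U V W : T U V W = T U W V by rewrite /T crossC.
exact: (polarization TDl TDm TC phiP X Y Z).
Qed.

(** Used with [e] an instance of [e6_polarized] at basis elements; [c] normalizes the coefficient of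
    the coordinate to be isolated. *)
Lemma eq_of_multiple (c e x y : K) : e = 0 -> x - y = c * e -> x = y.
Proof. by move=> -> /eqP; rewrite mulr0 subr_eq0 => /eqP. Qed.

Local Notation E1 := (sym3 1 0 0 0 0 0).
Local Notation E2 := (sym3 0 1 0 0 0 0).
Local Notation E3 := (sym3 0 0 1 0 0 0).
Local Notation F3 := (sym3 0 0 0 1 0 0).
Local Notation F2 := (sym3 0 0 0 0 1 0).
Local Notation F1 := (sym3 0 0 0 0 0 1).

Lemma sym3_sum a b c d e f : sym3 a b c d e f =
  a *: E1 + b *: E2 + c *: E3 + d *: F3 + e *: F2 + f *: F1.
Proof. by rewrite !sym3E; congr sym3; ring. Qed.

Lemma e6_action : exists2 N, \tr N = 0 & phi = linfun (sym_action N).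
Proof.
have [a1 [a2 [a3 [a4 [a5 [a6 E1E]]]]]] := sym3_ex (phi E1).
have [b1 [b2 [b3 [b4 [b5 [b6 E2E]]]]]] := sym3_ex (phi E2).
have [c1 [c2 [c3 [c4 [c5 [c6 E3E]]]]]] := sym3_ex (phi E3).
have [d1 [d2 [d3 [d4 [d5 [d6 F3E]]]]]] := sym3_ex (phi F3).
have [e1 [e2 [e3 [e4 [e5 [e6 F2E]]]]]] := sym3_ex (phi F2).
have [f1 [f2 [f3 [f4 [f5 [f6 F1E]]]]]] := sym3_ex (phi F1).
have E := (E1E, E2E, E3E, F1E, F2E, F3E); have H X Y Z := e6_polarized X Y Z.
(* The coordinates of the images must be those of M X + X M^T, where column j
   of M is read off phi E_j (and its diagonal entry halved). *)
have qa2 : a2 = 0.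
  by apply: (eq_of_multiple (c := 1) (H E1 E1 E3)); rewrite ?E ?coordE; field.
have qa3 : a3 = 0.
  by apply: (eq_of_multiple (c := 1) (H E1 E1 E2)); rewrite ?E ?coordE; field.
have qa6 : a6 = 0.
  by apply: (eq_of_multiple (c := - 2^-1) (H E1 E1 F1)); rewrite ?E ?coordE; field.
have qb1 : b1 = 0.
  by apply: (eq_of_multiple (c := 1) (H E2 E2 E3)); rewrite ?E ?coordE; field.
have qb3 : b3 = 0.
  by apply: (eq_of_multiple (c := 1) (H E2 E2 E1)); rewrite ?E ?coordE; field.
have qb5 : b5 = 0.
  by apply: (eq_of_multiple (c := - 2^-1) (H E2 E2 F2)); rewrite ?E ?coordE; field.
have qc1 : c1 = 0.
  by apply: (eq_of_multiple (c := 1) (H E3 E3 E2)); rewrite ?E ?coordE; field.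
have qc2 : c2 = 0.
  by apply: (eq_of_multiple (c := 1) (H E3 E3 E1)); rewrite ?E ?coordE; field.
have qc4 : c4 = 0.
  by apply: (eq_of_multiple (c := - 2^-1) (H E3 E3 F3)); rewrite ?E ?coordE; field.
have qd3 : d3 = 0.
  by apply: (eq_of_multiple (c := 2) (H F3 E1 E2)); rewrite ?E ?coordE; field.
have qe2 : e2 = 0.
  by apply: (eq_of_multiple (c := 2) (H F2 E1 E3)); rewrite ?E ?coordE; field.
have qf1 : f1 = 0.
  by apply: (eq_of_multiple (c := 2) (H F1 E2 E3)); rewrite ?E ?coordE; field.
(* This relation makes the trace of the matrix exhibited below vanish. *)
have qa1 : a1 = - b2 - c3.
  by apply: (eq_of_multiple (c := 2) (H E1 E2 E3)); rewrite ?E ?coordE; field.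
have qd1 : d1 = 2 * b4.
  by apply: (eq_of_multiple (c := 2) (H F3 E2 E3)); rewrite ?E ?coordE; field.
have qd2 : d2 = 2 * a4.
  by apply: (eq_of_multiple (c := 2) (H F3 E1 E3)); rewrite ?E ?coordE; field.
have qe1 : e1 = 2 * c5.
  by apply: (eq_of_multiple (c := 2) (H F2 E2 E3)); rewrite ?E ?coordE; field.
have qe3 : e3 = 2 * a5.
  by apply: (eq_of_multiple (c := 2) (H F2 E1 E2)); rewrite ?E ?coordE; field.
have qf2 : f2 = 2 * c6.
  by apply: (eq_of_multiple (c := 2) (H F1 E1 E3)); rewrite ?E ?coordE; field.
have qf3 : f3 = 2 * b6.
  by apply: (eq_of_multiple (c := 2) (H F1 E1 E2)); rewrite ?E ?coordE; field.
have qd4 : d4 = - (2^-1 * c3).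
  by apply: (eq_of_multiple (c := - 2^-1) (H F3 F3 E3)); rewrite ?E ?coordE; field.
have qe5 : e5 = - (2^-1 * b2).
  by apply: (eq_of_multiple (c := - 2^-1) (H F2 F2 E2)); rewrite ?E ?coordE; field.
have qf6 : f6 = 2^-1 * (b2 + c3).
  (* The identity itself gives f6 = - a1 / 2; [qa1] then eliminates a1. *)
  by apply: (eq_of_multiple (c := - 2^-1) (H F1 F1 E1)); rewrite ?E ?coordE qa1; field.
have qd5 : d5 = b6.
  by apply: (eq_of_multiple (c := -1) (H F3 E2 F2)); rewrite ?E ?coordE; field.
have qd6 : d6 = a5.
  by apply: (eq_of_multiple (c := -1) (H F3 E1 F1)); rewrite ?E ?coordE; field.
have qe4 : e4 = c6.
  by apply: (eq_of_multiple (c := -1) (H F2 E3 F3)); rewrite ?E ?coordE; field.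
have qe6 : e6 = a4.
  by apply: (eq_of_multiple (c := -1) (H F2 E1 F1)); rewrite ?E ?coordE; field.
have qf4 : f4 = c5.
  by apply: (eq_of_multiple (c := -1) (H F1 E3 F3)); rewrite ?E ?coordE; field.
have qf5 : f5 = b4.
  by apply: (eq_of_multiple (c := -1) (H F1 E2 F2)); rewrite ?E ?coordE; field.
exists (mx3 (2^-1 * a1) b4 c5 a4 (2^-1 * b2) c6 a5 b6 (2^-1 * c3)).
  by rewrite mx3_trace qa1; ring.
apply/lfunP => X; rewrite lfunE /= [X]sym3_eta.
(* Only the argument of [phi] is expanded over the basis, so that the known images appear; the other
   side is computed by [sym3_action]. *)
rewrite {1}(sym3_sum (X 0 0)) !linearD !linearZ /= ?E ?coordE.
rewrite qa2 qa3 qa6 qb1 qb3 qb5 qc1 qc2 qc4 qd3 qe2 qf1 qd1 qd2 qe1 qe3 qf2 qf3.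
rewrite qd4 qe5 qf6 qd5 qd6 qe4 qe6 qf4 qf5 qa1.
by congr sym3; field.
Qed.

End E6.

End Symmetric.

(** * Lie isomorphisms from a common parametrization *)

(** The isomorphism is [Q \o P']. An explicit left inverse [P'] is taken because the map must be
    defined on all of [L]; [br] is a bare operation, the Lie axioms being those of the targets. *)
Lemma lie_isomorphic_parametrized (K : pzRingType) (L M : lieAlgType K)
    (T : lmodType K) (br : T -> T -> T) (P : T -> L) (Q : T -> M) (P' : L -> T)
    (S : L -> Prop) (S' : M -> Prop) :
  linear P -> linear Q ->
  (forall t u, P (br t u) = lie (P t) (P u)) ->
  (forall t u, Q (br t u) = lie (Q t) (Q u)) ->
  cancel P P' -> injective Q ->
  (forall x, S x <-> exists t, x = P t) ->
  (forall x, S' x <-> exists t, x = Q t) ->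
  lie_isomorphic S S'.
Proof.
move=> linP linQ brP brQ PK injQ SE S'E.
have subalg (N : lieAlgType K) (F : T -> N) (U : N -> Prop) : linear F ->
    (forall t u, F (br t u) = lie (F t) (F u)) ->
    (forall x, U x <-> exists t, x = F t) -> lie_subalgebra U.
  move=> linF brF UE; split.
  (* Zero is written so that the bare linearity equation applies and gives - F 0 + F 0. *)
  - by apply/UE; exists (-1 *: 0 + 0); rewrite linF scaleN1r addNr.
  - by move=> a x y /UE[t ->] /UE[u ->]; apply/UE; exists (a *: t + u); rewrite linF.
  - by move=> x y /UE[t ->] /UE[u ->]; apply/UE; exists (br t u); rewrite brF.
split; [exact: subalg linP _ _ | exact: subalg linQ _ _ | exists (Q \o P')].
split=> /=.
- by move=> x /SE[t ->]; apply/S'E; exists t; rewrite PK.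
- by move=> a x y /SE[t ->] /SE[u ->]; rewrite -linP !PK linQ.
- by move=> x y /SE[t ->] /SE[u ->]; rewrite -brP !PK brQ.
- by move=> x y /SE[t ->] /SE[u ->]; rewrite !PK => /injQ ->.
- by move=> z /S'E[t ->]; exists (P t); [apply/SE; exists t | rewrite PK].
Qed.

(** * The Lie algebra sp(6) and its identification with e7 *)

Section Freudenthal.
Variable K : numFieldType.
Local Notation J := (symmx K).
Implicit Types (X Y : J) (xi eta : K).

Lemma freudenthalZ a X Y xi eta :
  a *: ((X, Y, xi, eta) : freudenthal K) = (a *: X, a *: Y, a * xi, a * eta).
Proof. by []. Qed.

Lemma freudenthalD X Y xi eta X' Y' xi' eta' :
  (X, Y, xi, eta) + (X', Y', xi', eta') =
    (X + X', Y + Y', xi + xi', eta + eta') :> freudenthal K.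
Proof. by []. Qed.

Lemma freudenthalN X Y xi eta :
  - ((X, Y, xi, eta) : freudenthal K) = (- X, - Y, - xi, - eta).
Proof. by []. Qed.

End Freudenthal.

Section Sp6.
Variable K : numFieldType.
Local Notation J := (symmx K).
Local Notation sp6 := ('M[K]_3 * J * J)%type.
Implicit Types (t u : sp6) (A B X Y : J) (N : 'M[K]_3).

(* [(N, A, B)] stands for the element [[N, A], [B, - N^T]] of sp(6, K). *)
Definition sp6_lie t u : sp6 :=
  let: (N, A, B) := t in let: (N', A', B') := u in
  (N *m N' - N' *m N + A *m B' - A' *m B,
   sym_action N A' - sym_action N' A,
   sym_action N'^T B - sym_action N^T B').

Definition sp6_Phi t : 'End(freudenthal K) :=
  let: (N, A, B) := t in
  Phi (linfun (sym_action (N - (3^-1 * \tr N)%:M))) A B (\tr N).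

Lemma sym_action_sub_scalar N c X :
  sym_action (N - c%:M) X = sym_action N X - (2 * c) *: X.
Proof.
rewrite [N]mx3_eta [X]sym3_eta ?coordE; congr sym3; ring.
Qed.

(** Removing (tr N / 3) 1 from N shifts the action by 2 tr N / 3, and the nu / 3 term of [Phi]
    supplies the remaining third. *)
Lemma sp6_PhiE N A B X Y (xi eta : K) :
  sp6_Phi (N, A, B) (X, Y, xi, eta) =
    (sym_action N X - \tr N *: X + 2 *: cross B Y + eta *: A,
     2 *: cross A X - sym_action N^T Y + \tr N *: Y + xi *: B,
     jform A Y + \tr N * xi,
     jform B X - \tr N * eta) :> freudenthal K.
Proof.
rewrite PhiE adj_sym_action !lfunE /= linearB /= tr_scalar_mx.
rewrite !sym_action_sub_scalar.
have tr3 (Z : J) : (2 * (3^-1 * \tr N)) *: Z + (3^-1 * \tr N) *: Z = \tr N *: Z.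
  by rewrite -scalerDl; congr (_ *: Z); field.
rewrite -[sym_action N X - _ - _]addrA -opprD tr3.
by rewrite opprB [_ *: Y - _]addrC !addrA -[_ + _ *: Y + _ *: Y]addrA tr3.
Qed.

Fact sp6_Phi_linear : linear sp6_Phi.
Proof.
move=> a [[N A] B] [[N' A'] B']; apply/lfunP => -[[[X Y] xi] eta].
have -> : a *: (N, A, B) + (N', A', B')
    = (a *: N + N', a *: A + A', a *: B + B') :> sp6 by [].
rewrite add_lfunE scale_lfunE !sp6_PhiE freudenthalZ freudenthalD.
rewrite [N]mx3_eta [N']mx3_eta [A]sym3_eta [A']sym3_eta.
rewrite [B]sym3_eta [B']sym3_eta [X]sym3_eta [Y]sym3_eta.
congr (_, _, _, _).
- rewrite ?coordE; by congr sym3; field.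
- rewrite ?coordE; by congr sym3; field.
- rewrite ?coordE; by field.
- rewrite ?coordE; by field.
Qed.

(** Both endomorphisms are evaluated at a generic vector; in coordinates each of the four components
    is a polynomial identity. *)
Lemma sp6_Phi_lie t u : sp6_Phi (sp6_lie t u) = lie (sp6_Phi t) (sp6_Phi u).
Proof.
case: t u => [[N A] B] [[N' A'] B']; apply/lfunP => -[[[X Y] xi] eta].
rewrite add_lfunE opp_lfunE !comp_lfunE !sp6_PhiE freudenthalN freudenthalD.
rewrite [N]mx3_eta [N']mx3_eta [A]sym3_eta [A']sym3_eta.
rewrite [B]sym3_eta [B']sym3_eta [X]sym3_eta [Y]sym3_eta.
congr (_, _, _, _).
- rewrite ?coordE; by congr sym3; field.
- rewrite ?coordE; by congr sym3; field.
- rewrite ?coordE; by field.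
- rewrite ?coordE; by field.
Qed.

Lemma e7_sp6 (f : 'End(freudenthal K)) : e7 f <-> exists t, f = sp6_Phi t.
Proof.
split=> [[phi [A [B [nu [/e6_action[N trN ->] ->]]]]] | [[[N A] B] ->]].
  exists (N + (3^-1 * nu)%:M, A, B); rewrite /sp6_Phi.
  have -> : \tr (N + (3^-1 * nu)%:M) = nu.
    by rewrite mxtraceD trN add0r mxtrace_scalar; field.
  by rewrite addrK.
exists (linfun (sym_action (N - (3^-1 * \tr N)%:M))), A, B, (\tr N); split=> //.
apply: e6_sym_action; rewrite linearB /= mxtrace_scalar; by field.
Qed.

(* By [sp6_PhiE], the j-th diagonal matrix unit is sent to a matrix with column
   j that of N, except for the diagonal entry 2 N_jj - tr N. *)
Definition sp6_of_End (f : 'End(freudenthal K)) : sp6 :=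
  let: (A, _, _, _) := f (0, 0, 0, 1) in
  let: (_, B, nu, _) := f (0, 0, 1, 0) in
  let: (P, _, _, _) := f (sym3 1 0 0 0 0 0, 0, 0, 0) in
  let: (Q, _, _, _) := f (sym3 0 1 0 0 0 0, 0, 0, 0) in
  let: (R, _, _, _) := f (sym3 0 0 1 0 0 0, 0, 0, 0) in
  (mx3 (2^-1 * (P 0 0 + nu)) (Q 0 1) (R 0 2)
       (P 0 1) (2^-1 * (Q 1 1 + nu)) (R 1 2)
       (P 0 2) (Q 1 2) (2^-1 * (R 2 2 + nu)), A, B).

Lemma sp6_PhiK : cancel sp6_Phi sp6_of_End.
Proof.
case=> [[N A] B]; rewrite /sp6_of_End !sp6_PhiE.
rewrite !(linear0, scaler0, scale0r, scale1r, mulr1, mulr0, add0r, addr0).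
congr (_, _, _).
rewrite [N in RHS]mx3_eta [N]mx3_eta ?coordE /= !mxE /=.
by congr mx3; field.
Qed.

End Sp6.

(** * The quaternionic side: sp(6) and sp(3) over the quaternions *)

Section QuaternionicSp3.
Variable K : numFieldType.
Variable im : K.
Hypothesis im2 : im * im = -1.
Local Notation J := (symmx K).
Local Notation sp6 := ('M[K]_3 * J * J)%type.

(* The isomorphism of M(2, K) with [quat K] for which i = diag(im, -im) and
   j = [[0, 1], [-1, 0]], applied to the 2 x 2 matrices of (i, j) entries of
   the four blocks. *)
Definition sp6_quat (t : sp6) : quat_mx K :=
  let: (N, A, B) := t in
  \matrix_(i, j) Quat (2^-1 * (N i j - N j i)) (- (im * 2^-1) * (N i j + N j i))
                      (2^-1 * (A i j - B i j)) (- (im * 2^-1) * (A i j + B i j)).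

Fact sp6_quat_linear : linear sp6_quat.
Proof.
move=> a [[N A] B] [[N' A'] B']; apply/matrixP => i j.
by rewrite !mxE /=; congr Quat; rewrite /= ?mxE; ring.
Qed.

(** The blocks are read back entrywise as N = q1 + im qi, A = qj + im qk and B = - qj + im qk. *)
Lemma sp6_quat_inj : injective sp6_quat.
Proof.
move=> [[N A] B] [[N' A'] B'] /matrixP e.
have Ne i j : N i j = N' i j.
  have := e i j; rewrite !mxE => -[h1 h2 _ _].
  transitivity (2^-1 * (N i j - N j i) + im * (- (im * 2^-1) * (N i j + N j i))).
    by field: im2.
  by rewrite h1 h2; field: im2.
have Ae i j : A i j = A' i j.
  have := e i j; rewrite !mxE => -[_ _ h1 h2].
  transitivity (2^-1 * (A i j - B i j) + im * (- (im * 2^-1) * (A i j + B i j))).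
    by field: im2.
  by rewrite h1 h2; field: im2.
have Be i j : B i j = B' i j.
  have := e i j; rewrite !mxE => -[_ _ h1 h2].
  transitivity (- (2^-1 * (A i j - B i j)) + im * (- (im * 2^-1) * (A i j + B i j))).
    by field: im2.
  by rewrite h1 h2; field: im2.
by congr (_, _, _); first [exact/matrixP | exact/val_inj/matrixP].
Qed.

(** The condition on D says that its real part is antisymmetric and its i, j, k parts are symmetric.
    The first two parts assemble into an arbitrary N, the last two into symmetric A and B. *)
Lemma sp3_sp6 (D : quat_mx K) : sp3 D <-> exists t, D = sp6_quat t.
Proof.
split=> [/matrixP DP | [[[N A] B] ->]]; last first.
  apply/matrixP => i j; rewrite !mxE [A j i]symmxE [B j i]symmxE.
  by congr Quat => /=; ring.
have D1 i j : q1 (D j i) = - q1 (D i j).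
  by have := DP i j; rewrite !mxE => -[/eqP]; rewrite addrC addr_eq0 => /eqP.
have Di i j : qi (D j i) = qi (D i j).
  by have := DP i j; rewrite !mxE => -[_ /eqP]; rewrite subr_eq0 => /eqP.
have Dj i j : qj (D j i) = qj (D i j).
  by have := DP i j; rewrite !mxE => -[_ _ /eqP]; rewrite subr_eq0 => /eqP.
have Dk i j : qk (D j i) = qk (D i j).
  by have := DP i j; rewrite !mxE => -[_ _ _ /eqP]; rewrite subr_eq0 => /eqP.
pose N : 'M[K]_3 := \matrix_(i, j) (q1 (D i j) + im * qi (D i j)).
have A_sym : \matrix_(i, j) (qj (D i j) + im * qk (D i j)) \in @sym_pred K.
  by apply/sym_predP/matrixP => i j; rewrite !mxE Dj Dk.
have B_sym : \matrix_(i, j) (- qj (D i j) + im * qk (D i j)) \in @sym_pred K.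
  by apply/sym_predP/matrixP => i j; rewrite !mxE Dj Dk.
exists (N, SymMx A_sym, SymMx B_sym); apply/matrixP => i j; rewrite !mxE.
rewrite (D1 i j) (Di i j); case: (D i j) => a b c d /=.
by congr Quat; field: im2.
Qed.

Lemma sp6_quat_lie t u : sp6_quat (sp6_lie t u) = lie (sp6_quat t) (sp6_quat u).
Proof.
case: t u => [[N A] B] [[N' A'] B']; apply/matrixP => i j.
rewrite /lie /= /qmx_lie !mxE !sum3E !mxE.
(* Summation indices move to the second place, so that equal entries of a symmetric matrix become
   the same atom for [field]. *)
rewrite !(symmxE _ 0) !(symmxE _ 1) !(symmxE _ 2).
congr Quat => /=.
all: by field: im2.
Qed.

Lemma e7_sp3_isomorphic : lie_isomorphic (@e7 K) (@sp3 K).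
Proof.
exact: lie_isomorphic_parametrized (sp6_Phi_linear (K := K)) sp6_quat_linear
  (@sp6_Phi_lie K) sp6_quat_lie (@sp6_PhiK K) sp6_quat_inj (@e7_sp6 K) sp3_sp6.
Qed.

End QuaternionicSp3.

Theorem theorem5p3 (R : realType) :
  lie_isomorphic (@e7 R[i]%C) (@sp3 R[i]%C).
Proof. exact: e7_sp3_isomorphic (sqr_i R). Qed.
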